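(* Let $a:\mathbb{C}\to\mathbb{C}$ be smooth with $a(0)\ne0$, let $b$ be a nonzero real number, let $\eta:\mathbb{R}\to\mathbb{R}$ be smooth with $\eta^{-1}(-b^2)=I$ for some interval $I$ of positive length, and let $\theta:\mathbb{C}\to\mathbb{R}$ be smooth. Put $$r(z_1,z_2)=\left|z_1\,a(z_1)+b\,e^{i\theta(z_2)}\right|^2+\eta(|z_2|^2),$$ $\Omega=\{z\in\mathbb{C}^2: r(z)<0\}$ (a smooth domain) and $E=\{(0,z_2):\eta(|z_2|^2)=-b^2\}\subset\partial\Omega$. Then for each $k\in\mathbb{Z}^+$, $\Omega$ satisfies the disc property of index $k$ at every $p\in E$.
   Context: ''Smooth'' means $C^\infty$; it is a standing convention that $\Omega$ is a smooth domain, with defining function $r$. Disc property of index $k$: let $\Omega\subset\mathbb{C}^n$ ($n\ge2$) be a domain with $C^1$ boundary, $k\in\mathbb{Z}^+$, $p\in\partial\Omega$, $N_p$ the unit outward normal vector and $L_p$ a unit complex tangential vector at $p$ (a unit vector in the maximal complex subspace of $T_p\partial\Omega$), both regarded as vectors in $\mathbb{C}^n$. $\Omega$ satisfies the disc property of index $k$ along $L_p$ at $p$ if there are $\delta_p>0$, $c_1>0$, $c_2>0$ such that for every $0<\delta\le\delta_p$, with $Q=p-\delta N_p$, $$\left\{Q-w_1N_p+w_2L_p:\ (w_1,w_2)\in W^{1/k}\right\}\subset\Omega,$$ where $W^{1/k}:=\{(w_1,w_2)\in\mathbb{C}^2: |w_1|\le c_1\delta,\ |w_2|\le c_2\delta^{1/k}\}$.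 Since here $\Omega\subset\mathbb{C}^2$, there is only one complex tangential direction at each boundary point (up to a unimodular complex factor), and ''the disc property at $p$'' means the disc property along that direction. *)

(* Defs.v *)
(* MathComp-Analysis, over an arbitrary [R : realType]. *)
From HB Require Import structures.
From mathcomp Require Export all_boot all_order all_algebra complex.
From mathcomp Require Export all_classical all_reals all_analysis.
Export Order.TTheory GRing.Theory Num.Theory.
Export numFieldNormedType.Exports ComplexField.Normc.

#[export] Set Implicit Arguments.
#[export] Unset Strict Implicit.
#[export] Unset Printing Implicit Defensive.

Local Open Scope classical_set_scope.
Local Open Scope ring_scope.
Local Open Scope complex_scope.

(* [R[i]] carries its topology through the regular alias [_^o]; the norm of
   [Cplx R] as a normed module is [R[i]]-valued, the [R]-valued modulus is
   [normc]. *)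
Notation Cplx R := (R[i]^o).
Notation Cvec R n := 'rV[Cplx R]_n.

Definition cexpi (R : realType) (t : R) : Cplx R := cos t +i* sin t.

(** ** Real differentiability on complex spaces *)

Section RealSmoothness.
Variables (R : realType) (V : normedModType R[i]).

Definition along (f : V -> R) (x v : V) : R -> R :=
  fun t => f (x + t%:C *: v).

(* Real directional derivative of [f] in the direction [v]. *)
Definition rderiv (f : V -> R) (v x : V) : R := derive1 (along f x v) 0.

(* [f] is of class C^m, in the real sense, on the open set [U].  Quantifying
   over all directions is the same as quantifying over the real coordinate
   directions when [V] is finite-dimensional. *)
Fixpoint Ck_on (U : set V) (m : nat) (f : V -> R) : Prop :=
  (forall x, U x -> {for x, continuous f}) /\
  if m is m'.+1 then
    (forall x v, U x -> derivable (along f x v) 0 1) /\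
    (forall v, Ck_on U m' (rderiv f v))
  else True.

Definition smooth (f : V -> R) : Prop := forall m, Ck_on setT m f.

Definition csmooth (f : V -> Cplx R) : Prop :=
  smooth (fun x => complex.Re (f x)) /\ smooth (fun x => complex.Im (f x)).

End RealSmoothness.

Definition smooth1 (R : realType) (f : R -> R) : Prop :=
  forall m x, derivable (derive1n m f) x 1.

(** ** Geometry of C^n *)

Section Geometry.
Variables (R : realType) (n : nat).
Implicit Types (v w p N L : Cvec R n) (rho : Cvec R n -> R).
Implicit Types (Omega U : set (Cvec R n)).

Definition hdot v w : R[i] := \sum_j (v 0 j : R[i]) * (w 0 j : R[i])^*.

Definition enorm v : R := Num.sqrt (\sum_j normc (v 0 j) ^+ 2).

(* The Euclidean gradient of R^{2n} = C^n, read as a complex vector: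
   its j-th entry is d rho/dx_j + i d rho/dy_j. *)
Definition grad rho p : Cvec R n :=
  \row_j (rderiv rho (delta_mx 0 j) p +i* rderiv rho ('i%C *: delta_mx 0 j) p).

Definition boundary Omega : set (Cvec R n) := closure Omega `\` Omega°.

Definition domain Omega : Prop :=
  [/\ open Omega, connected Omega & Omega !=set0].

Definition C1_local_defining Omega p rho : Prop :=
  exists U, [/\ open_nbhs p U, Ck_on U 1 rho,
                Omega `&` U = [set z | rho z < 0] `&` U & grad rho p != 0].

Definition C1_domain Omega : Prop :=
  domain Omega /\
  forall p, boundary Omega p -> exists rho, C1_local_defining Omega p rho.

Definition smooth_domain Omega rho : Prop :=
  [/\ domain Omega, smooth rho, Omega = [set z | rho z < 0] &
      forall p, boundary Omega p -> grad rho p != 0].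

Definition outward_unit_normal Omega p N : Prop :=
  exists2 rho, C1_local_defining Omega p rho &
    N = (enorm (grad rho p))^-1%:C *: grad rho p.

(* [Re (hdot v w)] is the real inner product of R^{2n}, so the first and second
   orthogonality conditions say that L and iL lie in the real tangent space. *)
Definition unit_complex_tangent N L : Prop :=
  [/\ enorm L = 1, complex.Re (hdot L N) = 0 &
      complex.Re (hdot ('i%C *: L) N) = 0].

Definition disc_region (k : nat) (c1 c2 delta : R) : set (Cplx R * Cplx R) :=
  [set w | normc w.1 <= c1 * delta /\ normc w.2 <= c2 * delta `^ (k%:R^-1)].

Definition disc_property_along (k : nat) Omega p N L : Prop :=
  exists deltap c1 c2 : R, [/\ 0 < deltap, 0 < c1, 0 < c2 &
    forall delta : R, 0 < delta -> delta <= deltap ->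
      let Q := p - delta%:C *: N in
      [set Q - w.1 *: N + w.2 *: L | w in disc_region k c1 c2 delta]
        `<=` Omega].

(* The unit outward normal N at p is unique; L ranges over all unit complex
   tangential vectors at p. *)
Definition disc_property (k : nat) Omega p : Prop :=
  [/\ C1_domain Omega, boundary Omega p &
      forall N L, outward_unit_normal Omega p N -> unit_complex_tangent N L ->
        disc_property_along k Omega p N L].

End Geometry.

(** ** The functions and sets of the statement *)

Section Model.
Variable R : realType.
Variables (a : Cplx R -> Cplx R) (b : R) (eta : R -> R) (theta : Cplx R -> R).

Definition rdef (z : Cvec R 2) : R :=
  let z1 := z 0 0 in let z2 := z 0 1 in
  normc (z1 * a z1 + b%:C * cexpi (theta z2)) ^+ 2 + eta (normc z2 ^+ 2).

Definition Eset : set (Cvec R 2) :=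
  [set z | z 0 0 = 0 /\ eta (normc (z 0 1) ^+ 2) = - b ^+ 2].

End Model.

(* Main.v *)
Require Import Defs.
From mathcomp Require Import ring lra.

(** Expanding the square, with [g(z) = b a(z1) e^(-i theta(z2))],
<<
      r(z) = |z1|^2 |a(z1)|^2 + 2 Re (z1 g(z)) + (b^2 + eta(|z2|^2)).
>>
    At a point [p = (0, p2)] of E the number [|p2|^2] lies in a nondegenerate
    interval on which [eta + b^2] vanishes, so [eta + b^2] is flat there: it is
    bounded by every power of the distance to [|p2|^2] ([flat_on_interval]).  As
    [gam = g(p)] is nonzero, the linear term [2 Re (z1 gam)] dominates [r] as long
    as [z1] points into the half-plane [Re (z1 gam) < 0], away from its edge, and
    [|z2 - p2|^k] is small compared to [|z1|] ([rdef_lt0_on_cone]).  This region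
    is what the disc property of index [k] asks for, provided that the outward
    normal is [(gam^* / |gam|, 0)] and that the complex tangent is the [z2] axis.

    The normal may be given by any local C^1 defining function [rho], not just by
    [r].  Every direction [v] with [Re (v1 gam) < 0] enters [Omega]
    ([half_space_enters]), hence the derivative of [rho] along [v] is
    nonpositive.  This derivative is real-linear in [v], because [rho] is C^1
    ([rderivD], [rderiv_grad]), and a linear form nonpositive on a half-space is
    determined up to a nonnegative factor ([polar_half_space]). *)

Local Open Scope classical_set_scope.
Local Open Scope ring_scope.

(** * Directional derivatives of C^1 functions *)

Section DirectionalDerivatives.
Local Open Scope complex_scope.
Variables (R : realType) (V : normedModType R[i]).
Implicit Types (x v w : V) (f : V -> R).

(** The set of points [x + t v + s w] with [0 <= s <= t] is the triangle
    swept by the two-step path from [x] to [x + t (v + w)]; it shrinks to [x]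
    with [t], so small triangles stay inside any neighbourhood. *)
Lemma near_sector x v w (P : set V) : nbhs x P ->
  \forall t \near (0 : R)^'+, forall s, 0 <= s <= t ->
    P (x + t%:C *: v + s%:C *: w).
Proof.
move=> /nbhs_ballP[e /= e0 eP].
have norm_real (u : V) : `|u| = (complex.Re `|u|)%:C.
  by rewrite RRe_real // ger0_real.
have re_ge0 (u : V) : 0 <= complex.Re `|u| by rewrite -ler0c -norm_real.
set M := complex.Re `|v| + complex.Re `|w| + 1.
have M0 : 0 < M by rewrite /M ltr_wpDl // addr_ge0.
have eE : e = (complex.Re e)%:C by rewrite RRe_real ?gtr0_real.
have re0 : 0 < complex.Re e by rewrite -ltcR -eE.
near=> t => s /andP[s0 st].
have t0 : 0 < t by near: t; exact: nbhs_right_gt.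
apply: eP; rewrite -ball_normE /ball_ /=.
rewrite -addrA opprD addNKr normrN eE.
apply: (le_lt_trans (ler_normD _ _)); rewrite !normrZ !normc_def /=.
rewrite !expr0n /= !addr0 !sqrtr_sqr !ger0_norm ?(ltW t0)//.
rewrite (norm_real v) (norm_real w) -!rmorphM -rmorphD /= ltcR.
apply: (@le_lt_trans _ _ (t * M)).
  rewrite /M !mulrDr mulr1 -addrA lerD2l.
  by apply: ler_wpDr; [exact: ltW | exact: ler_wpM2r].
by rewrite -ltr_pdivlMr//; near: t; apply: nbhs_right_lt; rewrite divr_gt0.
Unshelve. all: by end_near. Qed.

Lemma is_derive_along f x w (s : R) :
  derivable (along f (x + s%:C *: w) w) 0 1 ->
  is_derive s 1 (along f x w) (rderiv f w (x + s%:C *: w)).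
Proof.
move=> df.
have shiftE h : along f x w (h + s) = along f (x + s%:C *: w) w (h + 0).
  by rewrite /along addr0 rmorphD /= scalerDl -addrA [h%:C *: _ + _]addrC.
have qE (u : R) : (fun h => h^-1 *: ((along f x w \o shift s) (h *: u) - along f x w s))
  = (fun h => h^-1 *: ((along f (x + s%:C *: w) w \o shift 0) (h *: u)
       - along f (x + s%:C *: w) w 0)).
  apply/funext => h /=; rewrite shiftE; congr (_ *: (_ - _)).
  by rewrite -[in LHS](add0r s) shiftE addr0.
apply: DeriveDef; first by rewrite /derivable qE.
by rewrite /derive qE /rderiv derive1E.
Qed.

Lemma rderivZ f x v (c : R) :
  derivable (along f x v) 0 1 -> rderiv f (c%:C *: v) x = c * rderiv f v x.
Proof.
move=> df.
have alongE : along f x (c%:C *: v) = along f x v \o (fun t => c * t).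
  by apply/funext => t /=; rewrite /along scalerA -rmorphM mulrC.
rewrite /rderiv alongE !derive1E.
have -> : (fun t => c * t) = ( *%R c) by [].
have df' : is_derive (c * 0) 1 (along f x v) ('D_1 (along f x v) 0).
  by rewrite mulr0; apply: DeriveDef.
have dc : is_derive (0 : R) 1 ( *%R c) (c *: 1).
  have -> : ( *%R c) = c \*: (@id R) by apply/funext.
  exact: is_deriveZ.
have := is_derive1_comp df' dc.
by move=> /@derive_val ->; rewrite [_ *: _]mulr1 mulrC.
Qed.

Lemma cvg_rderiv_right f x v : derivable (along f x v) 0 1 ->
  (fun h => h^-1 * (f (x + h%:C *: v) - f x)) @ (0 : R)^'+ --> rderiv f v x.
Proof.
move=> df; rewrite /rderiv derive1E.
have qE : (fun h => h^-1 * (f (x + h%:C *: v) - f x)) =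
    (fun h => h^-1 *: ((along f x v \o shift 0) (h *: 1) - along f x v 0)).
  by apply/funext => h; rewrite /along /= [_ *: 1]mulr1 addr0 scale0r addr0.
rewrite qE => A /df /nbhs_ballP[_ /posnumP[e] eA].
by exists e%:num => //= y ye /gt_eqF/negbT; apply: eA.
Qed.

(** Additivity is where continuity of the derivatives is needed: existence of
    all directional derivatives would not give it.  The increment along
    [t (v + w)] is split into one along [t v], whose quotient converges by
    definition, and one along [t w] based at [x + t v], which the mean value
    theorem turns into [t] times [rderiv f w] at a point of the triangle. *)
Lemma rderivD f x v w (U : set V) : open U -> U x -> Ck_on U 1 f ->
  rderiv f (v + w) x = rderiv f v x + rderiv f w x.
Proof.
move=> Uo Ux [_ [df /(_ w)[/(_ x Ux) cw _]]].
suff cD : (fun h => h^-1 * (f (x + h%:C *: (v + w)) - f x)) @ (0 : R)^'+ -->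
    rderiv f v x + rderiv f w x.
  exact: cvg_unique (cvg_rderiv_right (df x (v + w) Ux)) cD.
apply/cvgrPdist_lt => e e0.
have e20 : 0 < e / 2 by rewrite divr_gt0.
have nU : \forall t \near (0 : R)^'+, forall s, 0 <= s <= t ->
    U (x + t%:C *: v + s%:C *: w).
  by apply: near_sector; exact: open_nbhs_nbhs.
have nw : \forall t \near (0 : R)^'+, forall s, 0 <= s <= t ->
    `|rderiv f w x - rderiv f w (x + t%:C *: v + s%:C *: w)| < e / 2.
  apply: (@near_sector x v w [set y | `|rderiv f w x - rderiv f w y| < e / 2]).
  by move/cvgrPdist_lt : cw; exact.
have nv : \forall t \near (0 : R)^'+,
    `|rderiv f v x - t^-1 * (f (x + t%:C *: v) - f x)| < e / 2.
  by have /cvgrPdist_lt := cvg_rderiv_right (df x v Ux); exact.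
near=> t.
have t0 : 0 < t by near: t; exact: nbhs_right_gt.
have dfw s : 0 <= s <= t -> is_derive s 1 (along f (x + t%:C *: v) w)
    (rderiv f w (x + t%:C *: v + s%:C *: w)).
  by move=> st; apply/is_derive_along/df; move: s st; near: t.
have [||s] := @MVT_segment R (along f (x + t%:C *: v) w)
    (fun s => rderiv f w (x + t%:C *: v + s%:C *: w)) 0 t (ltW t0).
- by move=> s; rewrite in_itv /= => /andP[s0 st]; apply: dfw; rewrite !ltW.
- apply: derivable_within_continuous => s; rewrite in_itv /= => st.
  by have [] := dfw s st.
rewrite in_itv /= => st; rewrite /along scale0r addr0 subr0 => fE.
have ws : `|rderiv f w x - rderiv f w (x + t%:C *: v + s%:C *: w)| < e / 2.
  by move: s st {fE}; near: t.
have vs : `|rderiv f v x - t^-1 * (f (x + t%:C *: v) - f x)| < e / 2.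
  by near: t.
have -> : rderiv f v x + rderiv f w x - t^-1 * (f (x + t%:C *: (v + w)) - f x) =
   (rderiv f w x - rderiv f w (x + t%:C *: v + s%:C *: w)) +
   (rderiv f v x - t^-1 * (f (x + t%:C *: v) - f x)).
  have -> : f (x + t%:C *: (v + w)) = f (x + t%:C *: v) +
     rderiv f w (x + t%:C *: v + s%:C *: w) * t.
    by rewrite -fE [RHS]addrC subrK scalerDr addrA.
  by field; rewrite gt_eqF.
by rewrite (splitr e); apply: (le_lt_trans (ler_normD _ _)); exact: ltrD.
Unshelve. all: by end_near. Qed.

End DirectionalDerivatives.

(** * Functions vanishing on an interval *)

Definition power_bounded (R : realType) (F : R -> R) (s : R) (m : nat) :=
  exists2 e : R, 0 < e & forall u, `|u - s| < e -> `|F u| <= `|u - s| ^+ m.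

Section Flat.
Variables (R : realType) (I : set R).
Hypothesis hI : is_interval I.
Hypothesis hIpos : exists x y : R, [/\ I x, I y & x < y].

Lemma interval_limit_point (s e : R) : I s -> 0 < e ->
  exists h, [/\ h != 0, `|h| < e & I (h + s)].
Proof.
move=> Is e0.
have [u Iu us] : exists2 u, I u & u != s.
  have [x [y [Ix Iy xy]]] := hIpos.
  have [xs|xs] := eqVneq x s; last by exists x.
  by exists y => //; rewrite -xs gt_eqF.
have [lt_us|lt_su|/eqP] := ltgtP u s; last by rewrite (negbTE us).
- have m0 : 0 < Num.min (e / 2) (s - u) by rewrite lt_min divr_gt0//= subr_gt0.
  exists (- Num.min (e / 2) (s - u)); split.
  + by rewrite oppr_eq0 gt_eqF.
  + by rewrite normrN gtr0_norm// gt_min; apply/orP; left; lra.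
  + apply: (hI Iu Is); apply/andP; split; last by lra.
    have : Num.min (e / 2) (s - u) <= s - u by rewrite ge_min lexx orbT.
    by lra.
- have m0 : 0 < Num.min (e / 2) (u - s) by rewrite lt_min divr_gt0//= subr_gt0.
  exists (Num.min (e / 2) (u - s)); split.
  + by rewrite gt_eqF.
  + by rewrite gtr0_norm// gt_min; apply/orP; left; lra.
  + apply: (hI Is Iu); apply/andP; split; first by lra.
    have : Num.min (e / 2) (u - s) <= u - s by rewrite ge_min lexx orbT.
    by lra.
Qed.

(** The difference quotients at [s] vanish along a sequence of increments that
    stays in the interval; this also covers an endpoint [s], where the quotient
    need not vanish on the other side. *)
Lemma derive1_eq0_on_interval (F : R -> R) (s : R) :
  derivable F s 1 -> (forall u, I u -> F u = 0) -> I s -> derive1 F s = 0.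
Proof.
move=> dF F0 Is; apply/eqP/negP => /negP d0; move: dF; rewrite /derivable -/('D_1 F s).
have -> : (fun h => h^-1 *: ((F \o shift s) (h *: 1) - F s)) =
    (fun h => h^-1 * (F (h + s) - F s)).
  by apply/funext => h; rewrite /= [_ *: 1]mulr1.
move=> dF; have : (fun h => h^-1 * (F (h + s) - F s)) @ 0^' --> derive1 F s by rewrite derive1E.
move=> /cvgrPdist_lt /(_ `|derive1 F s|); rewrite normr_gt0 => /(_ d0).
move=> /nbhs_ballP[e /= e0 eP].
have [h [h0 he Ih]] := interval_limit_point Is e0.
have := eP h; rewrite -ball_normE /= sub0r normrN => /(_ he h0).
by rewrite !F0// subrr mulr0 subr0 ltxx.
Qed.

(** All derivatives of [F] again vanish on the interval, so the bound of order
    [m] for [derive1 F] integrates, by the mean value theorem, to the bound of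
    order [m + 1] for [F]; the constant stays [1] since the intermediate point
    is closer to [s] than [u]. *)
Lemma flat_on_interval (m : nat) (F : R -> R) (s : R) :
  smooth1 F -> (forall u, I u -> F u = 0) -> I s ->
  power_bounded F s m.
Proof.
move=> + + Is; elim: m F => [|m IHm] F sF F0.
  have /derivable1_diffP/differentiable_continuous := sF 0%N s.
  move=> /cvgrPdist_lt /(_ 1 ltr01) /nbhs_ballP[e /= e0 eP].
  exists e => // u us; have := eP u; rewrite -ball_normE /= distrC => /(_ us).
  by rewrite F0// sub0r normrN expr0 => /ltW.
have [|u Iu|e e0 eP] := IHm (derive1 F).
- by move=> n x; rewrite -derive1Sn; exact: sF.
- exact: derive1_eq0_on_interval (sF 0%N u) F0 Iu.
have dF (x : R) : is_derive x 1 F (derive1 F x).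
  by apply: DeriveDef; [exact: (sF 0%N) | rewrite derive1E].
have cF : continuous F.
  by move=> x; apply/differentiable_continuous/derivable1_diffP; exact: (sF 0%N).
exists e => // u us.
have [c [cs ->]] : exists c, `|c - s| <= `|u - s| /\ F u = derive1 F c * (u - s).
  have [lt_us|lt_su|->] := ltgtP u s.
  - have [|c] := @MVT R F (derive1 F) u s lt_us.
      exact: continuous_subspaceT.
    rewrite in_itv /= => /andP[uc cs] E; exists c; split.
      by rewrite !ltr0_norm ?subr_lt0//; lra.
    by move: E; rewrite (F0 s Is) => E; lra.
  - have [|c] := @MVT R F (derive1 F) s u lt_su.
      exact: continuous_subspaceT.
    rewrite in_itv /= => /andP[uc cs] E; exists c; split.
      by rewrite !gtr0_norm ?subr_gt0//; lra.
    by move: E; rewrite (F0 s Is) => E; lra.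
  - by exists s; rewrite (F0 s Is) subrr mulr0.
rewrite normrM exprSr ler_wpM2r//.
apply: le_trans (eP _ (le_lt_trans cs us)) _.
exact: lerXn2r.
Qed.

End Flat.

Lemma smooth1_addr (R : realType) (f : R -> R) (c : R) :
  smooth1 f -> smooth1 (fun u => f u + c).
Proof.
move=> sf [|m] x.
  apply: (@derivableD R R R f (cst c)); [exact: (sf 0%N) | exact: derivable_cst].
have dfE : derive1 (fun u => f u + c) = derive1 f.
  apply/funext => u; rewrite /derive1.
  by under eq_fun do rewrite opprD addrACA subrr addr0.
by rewrite derive1Sn dfE -derive1Sn; exact: sf.
Qed.

(** * The complex modulus *)

Section Modulus.
Variable R : realType.
Local Open Scope complex_scope.
Implicit Types z : R[i].

Lemma normc_ge0 z : 0 <= normc z.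
Proof. by case: z => x y; exact: sqrtr_ge0. Qed.

Lemma sqr_normcE z : normc z ^+ 2 = complex.Re z ^+ 2 + complex.Im z ^+ 2.
Proof. by case: z => x y; rewrite sqr_sqrtr// addr_ge0// sqr_ge0. Qed.

Lemma normc_gt0 z : (0 < normc z) = (z != 0).
Proof.
rewrite lt_neqAle normc_ge0 andbT eq_sym; congr (~~ _).
by apply/eqP/eqP => [/eq0_normc|->]; rewrite ?normc0.
Qed.

Lemma normrE_Cplx (z : Cplx R) : `|z| = (normc z)%:C.
Proof. by rewrite normc_def; case: z. Qed.

Lemma Re_le_normc z : `|complex.Re z| <= normc z.
Proof.
by rewrite -sqrtr_sqr; case: z => x y /=; rewrite ler_wsqrtr// lerDl sqr_ge0.
Qed.

Lemma Im_le_normc z : `|complex.Im z| <= normc z.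
Proof.
by rewrite -sqrtr_sqr; case: z => x y /=; rewrite ler_wsqrtr// lerDr sqr_ge0.
Qed.

Lemma normc_conj z : normc z^* = normc z.
Proof. by case: z => x y /=; rewrite sqrrN. Qed.

Lemma normc_real (t : R) : normc t%:C = `|t|.
Proof. by rewrite /= expr0n addr0 sqrtr_sqr. Qed.

(** Balls of [Cplx R] have [R[i]]-valued radii; this restates them with a real
    radius and the real modulus. *)
Lemma near_CplxP (x : Cplx R) (P : set (Cplx R)) : nbhs x P ->
  exists2 d : R, 0 < d & forall y, normc (y - x) < d -> P y.
Proof.
move=> /nbhs_ballP[e /= e0 eP].
have eE : e = (complex.Re e)%:C by rewrite RRe_real ?gtr0_real.
exists (complex.Re e); first by rewrite -ltcR -eE.
move=> y xy; apply: eP; rewrite -ball_normE /ball_ /= distrC normrE_Cplx eE.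
by rewrite ltcR.
Qed.

Lemma sqr_normc_lipschitz (z w : R[i]) : normc (z - w) <= 1 ->
  `|normc z ^+ 2 - normc w ^+ 2| <= (2 * normc w + 1) * normc (z - w).
Proof.
move=> zw.
have := le_normcD (z - w) w; have := le_normcD (w - z) z.
rewrite !subrK -(normcN (w - z)) opprB.
have := normc_ge0 z; have := normc_ge0 w; have := normc_ge0 (z - w).
rewrite subr_sqr normrM; move: (normc _) zw (normc z) (normc w) => d d1 u v.
move=> d0 v0 u0 h1 h2.
have uv : `|u - v| <= d by rewrite ler_norml; apply/andP; split; lra.
rewrite mulrC (ger0_norm (addr_ge0 u0 v0)); apply: ler_pM => //; last lra.
exact: addr_ge0.
Qed.

End Modulus.

(** * The defining function near a point of E *)

Section ModelEstimate.
Variable R : realType.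
Local Open Scope complex_scope.
Variables (a : Cplx R -> Cplx R) (b : R) (eta : R -> R) (theta : Cplx R -> R).
Hypothesis ha : csmooth a.
Hypothesis htheta : smooth theta.

(** With [g = twist (z1, z2) = b a(z1) e^(-i theta(z2))], the cross term of the
    expanded square in [rdef] is [2 Re (z1 g)]. *)
Definition twist (z : Cplx R * Cplx R) : R[i] :=
  b%:C * a z.1 * (cexpi (theta z.2))^*.

Lemma rdefE (z : Cvec R 2) : rdef a b eta theta z =
  normc (z 0 0) ^+ 2 * normc (a (z 0 0)) ^+ 2
  + 2 * complex.Re (z 0 0 * twist (z 0 0, z 0 1))
  + (eta (normc (z 0 1) ^+ 2) + b ^+ 2).
Proof.
rewrite /rdef /twist /cexpi /=; set s := eta _; rewrite !sqr_normcE.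
have := cos2Dsin2 (theta (z 0 1)).
case: (z 0 0) => x y; case: (a _) => u v /=.
move: (cos _) (sin _) => c d cd.
have -> : b ^+ 2 = b ^+ 2 * (c ^+ 2 + d ^+ 2) by rewrite cd mulr1.
ring.
Qed.

Lemma cvg_twist (p : Cplx R) :
  complex.Re (twist z) @[z --> ((0 : Cplx R), p)] --> complex.Re (twist (0, p)) /\
  complex.Im (twist z) @[z --> ((0 : Cplx R), p)] --> complex.Im (twist (0, p)).
Proof.
have [/(_ 0%N)[cRe _] /(_ 0%N)[cIm _]] := ha.
have [cth _] := htheta 0%N.
have c1 (f : Cplx R -> R) : {for 0, continuous f} ->
    f z.1 @[z --> ((0 : Cplx R), p)] --> f 0.
  by move=> cf; apply: (@cvg_comp _ _ _ fst f _ (nbhs (0 : Cplx R))) => //; exact: cvg_fst.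
have c2 (f : Cplx R -> R) : {for p, continuous f} ->
    f z.2 @[z --> ((0 : Cplx R), p)] --> f p.
  by move=> cf; apply: (@cvg_comp _ _ _ snd f _ (nbhs p)) => //; exact: cvg_snd.
have cR := c1 _ (cRe 0 Logic.I); have cI := c1 _ (cIm 0 Logic.I).
have cC := c2 _ (continuous_comp (cth p Logic.I) (@continuous_cos R _)).
have cS := c2 _ (continuous_comp (cth p Logic.I) (@continuous_sin R _)).
have tE (z : Cplx R * Cplx R) : twist z =
   (b * complex.Re (a z.1) * cos (theta z.2) + b * complex.Im (a z.1) * sin (theta z.2))
   +i* (b * complex.Im (a z.1) * cos (theta z.2) - b * complex.Re (a z.1) * sin (theta z.2)).
  rewrite /twist /cexpi; case: (a _) => u v; apply/eqP; rewrite eq_complex /=.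
  by apply/andP; split; apply/eqP; ring.
split; under eq_fun do rewrite tE; rewrite tE /=.
- by apply: cvgD; apply: cvgM => //; apply: cvgM => //; exact: cvg_cst.
- by apply: cvgB; apply: cvgM => //; apply: cvgM => //; exact: cvg_cst.
Qed.

Lemma twist_close (p : Cplx R) (e : R) : 0 < e ->
  exists2 d : R, 0 < d & forall x y : Cplx R,
    normc x < d -> normc (y - p) < d ->
    `|complex.Re (x * twist (x, y)) - complex.Re (x * twist (0, p))|
      <= e * normc x.
Proof.
move=> e0; have [/cvgrPdist_lt cRe /cvgrPdist_lt cIm] := cvg_twist p.
have e20 : 0 < e / 2 by rewrite divr_gt0.
have [[P Q] /= [/near_CplxP[d1 d10 dP] /near_CplxP[d2 d20 dQ]] PQ] :=
  filterI (cRe _ e20) (cIm _ e20).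
exists (Num.min d1 d2); first by rewrite lt_min d10.
move=> x y; rewrite !lt_min => /andP[xd1 _] /andP[_ yd2].
have [] /= := PQ (x, y) (conj (dP x _) (dQ y yd2)); first by rewrite subr0.
have := Re_le_normc x; have := Im_le_normc x.
move: (normc x) {xd1 yd2} => n; case: x => x1 x2 /=.
case: (twist _) => r1 r2; case: (twist _) => s1 s2 /= hx2 hx1 h1 h2.
have -> : x1 * s1 - x2 * s2 - (x1 * r1 - x2 * r2) =
  x2 * (r2 - s2) - x1 * (r1 - s1) by ring.
apply: (le_trans (ler_normB _ _)); rewrite !normrM (splitr e) mulrDl.
by apply: lerD; rewrite mulrC; apply: ler_pM => //; exact: ltW.
Qed.

Lemma bounded_near0 : exists M d : R, [/\ 0 < M, 0 < d &
  forall x : Cplx R, normc x < d -> normc (a x) ^+ 2 <= M].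
Proof.
have [/(_ 0%N)[cRe _] /(_ 0%N)[cIm _]] := ha.
have cN : complex.Re (a x) ^+ 2 + complex.Im (a x) ^+ 2 @[x --> (0 : Cplx R)] -->
    complex.Re (a 0) ^+ 2 + complex.Im (a 0) ^+ 2.
  under eq_fun do rewrite !expr2.
  have cR := cRe 0 Logic.I; have cI := cIm 0 Logic.I.
  by rewrite !expr2; exact: cvgD (cvgM cR cR) (cvgM cI cI).
move/cvgrPdist_lt : cN => /(_ 1 ltr01)/near_CplxP[d d0 dP].
exists (normc (a 0) ^+ 2 + 1), d; split => //.
  by rewrite ltr_wpDl// sqr_ge0.
move=> x xd; have := dP x; rewrite subr0 => /(_ xd).
by rewrite !sqr_normcE ltr_norml => /andP[h _]; lra.
Qed.

(** Near [(0, p)] the three terms of [rdefE] compare as follows: the square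
    [|z1|^2 |a(z1)|^2] is [o(|z1|)]; the cross term is at most
    [- 2 kap |z1| + o(|z1|)] on the cone; and the [eta] term is bounded by a
    constant times [|z2 - p|^k], hence by a small multiple of [|z1|]. *)
Lemma rdef_lt0_on_cone (p : Cplx R) (k : nat) (kap : R) :
  power_bounded (fun u => eta u + b ^+ 2) (normc p ^+ 2) k ->
  0 < kap ->
  exists2 e : R, 0 < e & forall z : Cvec R 2,
    0 < normc (z 0 0) < e -> normc (z 0 1 - p) < e ->
    complex.Re (z 0 0 * twist (0, p)) <= - (kap * normc (z 0 0)) ->
    normc (z 0 1 - p) ^+ k <= e * normc (z 0 0) ->
    rdef a b eta theta z < 0.
Proof.
move=> [e1 e10 flat] kap0.
have [e2 e20 tw] := twist_close p (divr_gt0 kap0 (ltr0n R 2)).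
have [M [e3 [M0 e30 bd]]] := bounded_near0.
set C := 2 * normc p + 1.
have C0 : 0 < C by rewrite /C ltr_wpDl// mulr_ge0// normc_ge0.
have Ck0 : 0 < C ^+ k by rewrite exprn_gt0.
(* The last two bounds make the first and third terms at most
   [kap / 3 * |z1|]; the cross term leaves [- kap * |z1|]. *)
set e := Num.min (Num.min (Num.min 1 (e1 / C)) (Num.min e2 e3))
  (Num.min (kap / (3 * M)) (kap / (3 * C ^+ k))).
have e0 : 0 < e by rewrite !lt_min ltr01 e20 e30 !divr_gt0 ?mulr_gt0.
exists e => // z /andP[x0 xe] ye zcone zflat.
have := xe; have := ye; rewrite !lt_min.
move=> /andP[/andP[/andP[y1 ye1] /andP[ye2 ye3]] /andP[yM yk]].
move=> /andP[/andP[/andP[x1 xe1] /andP[xe2 xe3]] /andP[xM xk]].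
have term1 : normc (z 0 0) ^+ 2 * normc (a (z 0 0)) ^+ 2 <= kap / 3 * normc (z 0 0).
  apply: (@le_trans _ _ (normc (z 0 0) * M * normc (z 0 0))).
    by rewrite [leRHS]mulrAC -expr2 ler_wpM2l ?sqr_ge0// bd.
  rewrite ler_wpM2r ?normc_ge0// -ler_pdivlMr//.
  by rewrite -mulrA -invfM ltW.
have term2 : complex.Re (z 0 0 * twist (z 0 0, z 0 1)) <= - (kap / 2 * normc (z 0 0)).
  have := tw _ _ xe2 ye2; rewrite ler_norml => /andP[_].
  by move: zcone; move: (complex.Re _) (complex.Re _) (normc _) => r1 r2 n; lra.
have term3 : eta (normc (z 0 1) ^+ 2) + b ^+ 2 <= kap / 3 * normc (z 0 0).
  apply: le_trans (ler_norm _) _.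
  have lip := sqr_normc_lipschitz (ltW y1).
  apply: (le_trans (flat _ _)).
    by apply: (le_lt_trans lip); rewrite mulrC -ltr_pdivlMr.
  apply: (@le_trans _ _ ((C * normc (z 0 1 - p)) ^+ k)).
    by rewrite lerXn2r ?nnegrE ?mulr_ge0 ?normc_ge0// ltW.
  rewrite exprMn; apply: (@le_trans _ _ (C ^+ k * (e * normc (z 0 0)))).
    by rewrite ler_pM2l.
  rewrite mulrA ler_wpM2r ?normc_ge0// mulrC -ler_pdivlMr// -mulrA -invfM.
  by rewrite !ge_min lexx !orbT.
have kx : 0 < kap * normc (z 0 0) by rewrite mulr_gt0.
rewrite rdefE; move: term1 term2 term3 kx.
move: (_ * _ ^+ 2) (complex.Re _) (eta _ + _) => t1 t2 t3.
by move: (normc (z 0 0)) => n; lra.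
Qed.

End ModelEstimate.

(** * Normals and complex tangents *)

Section Normal.
Variable R : realType.
Local Open Scope complex_scope.

(** For a C^1 function the directional derivative is real-linear in the
    direction, so it is determined by the real coordinate directions, which
    are the entries of the gradient. *)
Lemma rderiv_grad n (rho : Cvec R n -> R) (U : set (Cvec R n)) (p v : Cvec R n) :
  open U -> U p -> Ck_on U 1 rho ->
  rderiv rho v p = complex.Re (hdot v (grad rho p)).
Proof.
move=> Uo Up CU; have [_ [drho _]] := CU.
have sumE (F : 'I_n -> Cvec R n) :
    rderiv rho (\sum_j F j) p = \sum_j rderiv rho (F j) p.
  elim/big_ind2 : _ => // [|x1 x2 y1 y2 <- <-].
    rewrite -[X in rderiv _ X](scale0r (0 : Cvec R n)) -[0 : R[i]]/(0%:C).
    by rewrite rderivZ ?mul0r//; exact: drho.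
  exact: rderivD CU.
have vE : v = \sum_j ((complex.Re (v 0 j))%:C *: delta_mx 0 j
    + (complex.Im (v 0 j))%:C *: ('i%C *: delta_mx 0 j)).
  rewrite [LHS]row_sum_delta; apply: eq_bigr => j _.
  by rewrite scalerA -scalerDl [in RHS]mulrC -complexE.
rewrite [in LHS]vE sumE raddf_sum; apply: eq_bigr => j _.
rewrite (rderivD _ _ Uo Up CU) !rderivZ; try exact: drho.
rewrite mxE; move: (rderiv _ _ _) (rderiv _ _ _) (v 0 j) => r s [x y] /=.
by rewrite mulrN opprK.
Qed.

(** The sign of [rho] on the ray gives the sign of its one-sided quotients;
    [rho p >= 0] because [p] lies outside [Omega]. *)
Lemma rderiv_le0_of_entering n (rho : Cvec R n -> R) (Omega : set (Cvec R n))
    (p v : Cvec R n) :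
  C1_local_defining Omega p rho -> ~ Omega p ->
  (\forall t \near (0 : R)^'+, Omega (p + t%:C *: v)) -> rderiv rho v p <= 0.
Proof.
move=> [U [[Uo Up] CU OU _]] nOp nO; have [_ [drho _]] := CU.
have rp : 0 <= rho p.
  rewrite leNgt; apply/negP => rp; apply: nOp.
  by have : ([set z | rho z < 0] `&` U) p by []; rewrite -OU => -[].
have nU : \forall t \near (0 : R)^'+, U (p + t%:C *: v).
  have := near_sector v 0 (open_nbhs_nbhs (conj Uo Up)).
  apply: filter_app; near=> t => /(_ 0).
  by rewrite scaler0 addr0 lexx; apply; apply: ltW; near: t; exact: nbhs_right_gt.
rewrite leNgt; apply/negP => /(cvgr_gt _ (cvg_rderiv_right (drho p v Up))) gt0.
have [t [[[t0 Ot] Ut] /=]] : exists t : R, ((0 < t /\ Omega (p + t%:C *: v)) /\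
    U (p + t%:C *: v)) /\ 0 < t^-1 * (rho (p + t%:C *: v) - rho p).
  apply: (@filter_ex _ (0 : R)^'+).
  by do ![apply: filterI => //]; exact: nbhs_right_gt.
have : (Omega `&` U) (p + t%:C *: v) by [].
rewrite OU => -[/= rt _]; apply/negP; rewrite -leNgt.
by rewrite pmulr_rle0 ?invr_gt0//; lra.
Unshelve. all: by end_near. Qed.

Lemma lift0_ord2 : lift ord0 ord0 = 1 :> 'I_2.
Proof. exact/val_inj. Qed.

Lemma Re_hdot2 (v w : Cvec R 2) : complex.Re (hdot v w) =
  complex.Re (v 0 0) * complex.Re (w 0 0) + complex.Im (v 0 0) * complex.Im (w 0 0)
  + (complex.Re (v 0 1) * complex.Re (w 0 1) + complex.Im (v 0 1) * complex.Im (w 0 1)).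
Proof.
rewrite /hdot big_ord_recl big_ord1 lift0_ord2.
case: (v 0 0) (v 0 1) (w 0 0) (w 0 1) => [x1 y1] [x2 y2] [u1 t1] [u2 t2] /=.
by rewrite !mulrN !opprK.
Qed.

Lemma enorm2E (v : Cvec R 2) :
  enorm v = Num.sqrt (normc (v 0 0) ^+ 2 + normc (v 0 1) ^+ 2).
Proof. by rewrite /enorm big_ord_recl big_ord1 lift0_ord2. Qed.

(** A real-linear form that is nonpositive on an open half-space is a
    nonnegative multiple of the form defining it.  Here the half-space
    [Re (v1 gam) < 0] of C^2 forces the gradient [g] to be a nonnegative multiple
    of [(gam^*, 0)]. *)
Lemma polar_half_space (gam : R[i]) (g : Cvec R 2) : gam != 0 ->
  (forall v : Cvec R 2, complex.Re (v 0 0 * gam) < 0 ->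
     complex.Re (hdot v g) <= 0) ->
  g 0 1 = 0 /\ g 0 0 * gam = (normc (g 0 0) * normc gam)%:C.
Proof.
move=> gam0 hg.
pose row2 (x y : R[i]) : Cvec R 2 := \row_j (if j == 0 then x else y).
have {}hg x y : complex.Re (x * gam) < 0 ->
    complex.Re x * complex.Re (g 0 0) + complex.Im x * complex.Im (g 0 0)
    + (complex.Re y * complex.Re (g 0 1) + complex.Im y * complex.Im (g 0 1)) <= 0.
  by move=> h; have := hg (row2 x y); rewrite Re_hdot2 !mxE /=; exact.
have nz0 (z : R[i]) : z != 0 -> 0 < complex.Re z ^+ 2 + complex.Im z ^+ 2.
  by move=> z0; rewrite -sqr_normcE exprn_gt0// normc_gt0.
have neg_conj (s : R) : complex.Re ((- gam^* + s%:C * 'i * gam^*) * gam) < 0.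
  by have := nz0 _ gam0; case: (gam) => c d /= h; nra.
have g1 : g 0 1 = 0.
  (* Otherwise a large multiple of [(0, g 0 1)], which does not affect
     membership in the half-space, would make the form positive. *)
  apply/eqP/negP => /negP g10; have := nz0 _ g10.
  set N := _ + _ => N0.
  set u := - gam^* + 0%:C * 'i * gam^*.
  set D := complex.Re u * complex.Re (g 0 0) + complex.Im u * complex.Im (g 0 0).
  have := hg _ (((1 - D) / N)%:C * g 0 1) (neg_conj 0).
  apply/negP; rewrite -ltNge -/u -/D.
  have -> : complex.Re (((1 - D) / N)%:C * g 0 1) = (1 - D) / N * complex.Re (g 0 1).
    by case: (g 0 1) => x y /=; rewrite mul0r subr0.
  have -> : complex.Im (((1 - D) / N)%:C * g 0 1) = (1 - D) / N * complex.Im (g 0 1).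
    by case: (g 0 1) => x y /=; rewrite mul0r addr0.
  have := divfK (lt0r_neq0 N0) (1 - D); rewrite [in _ * N]/N; move: (_ / N) => k kN.
  lra.
split => //; set q := g 0 0 * gam.
have qs (s : R) : - complex.Re q + s * complex.Im q <= 0.
  have := hg _ 0 (neg_conj s); rewrite /= !mul0r !addr0; congr (_ <= 0).
  by rewrite /q; case: (g 0 0) => x y; case: (gam) => c d /=; ring.
have q_real : complex.Im q = 0.
  (* This value of [s] makes the left side of [qs] equal to [1]. *)
  apply/eqP/negP => /negP q0.
  have := qs ((complex.Re q + 1) / complex.Im q).
  by rewrite divfK//; lra.
have q_ge0 : 0 <= complex.Re q by have := qs 0; lra.
rewrite -normcM -/q; move: q_real q_ge0; case: (q) => x y /= -> x0.
by rewrite expr0n addr0 sqrtr_sqr ger0_norm.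
Qed.

Lemma complex_tangent_of_axis_normal (N L : Cvec R 2) :
  N 0 1 = 0 -> N 0 0 != 0 -> unit_complex_tangent N L ->
  L 0 0 = 0 /\ normc (L 0 1) = 1.
Proof.
move=> N1 N0 [nL ReL ImL].
have L0 : L 0 0 = 0.
  apply: (@eq0_normc R).
  have : normc (L 0 0) ^+ 2 * normc (N 0 0) ^+ 2 = 0.
    move: ReL ImL; rewrite !Re_hdot2 N1 /= !mulr0 !addr0 !mxE !sqr_normcE.
    case: (L 0 0) (N 0 0) => x y [u t] /= h1 h2.
    (* The two tangency conditions are the real and imaginary parts of
       [L1 N1^*], whose squares add up to [|L1|^2 |N1|^2]. *)
    transitivity ((x * u + y * t) ^+ 2 +
      ((0 * x - 1 * y) * u + (0 * y + 1 * x) * t) ^+ 2); first by ring.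
    by rewrite h1 h2 expr0n addr0.
  move/eqP; rewrite mulf_eq0 !sqrf_eq0 => /orP[/eqP //|/eqP/(@eq0_normc R) N00].
  by rewrite N00 eqxx in N0.
split=> //; move: nL; rewrite enorm2E L0 normc0 expr0n add0r sqrtr_sqr.
by rewrite ger0_norm// normc_ge0.
Qed.

End Normal.

(** * The boundary points on the axis z1 = 0 *)

Section BoundaryPoint.
Variable R : realType.
Local Open Scope complex_scope.
Variables (a : Cplx R -> Cplx R) (b : R) (eta : R -> R) (theta : Cplx R -> R).
Hypothesis ha : csmooth a.
Hypothesis htheta : smooth theta.
Variables (Omega : set (Cvec R 2)) (p : Cvec R 2).
Hypothesis OmegaE : Omega = [set z | rdef a b eta theta z < 0].
Hypothesis p0 : p 0 0 = 0.
Hypothesis rp : rdef a b eta theta p = 0.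
Hypothesis flat : forall m : nat,
  power_bounded (fun u => eta u + b ^+ 2) (normc (p 0 1) ^+ 2) m.
Let gam := twist a b theta (0, p 0 1).
Hypothesis gam0 : gam != 0.

(** On a ray [z1] and [z2 - p2] are both linear in [t], so the cone of order
    [2] already contains the beginning of the ray. *)
Lemma half_space_enters (v : Cvec R 2) : complex.Re (v 0 0 * gam) < 0 ->
  \forall t \near (0 : R)^'+, Omega (p + t%:C *: v).
Proof.
move=> vg; have v0 : 0 < normc (v 0 0).
  by rewrite normc_gt0; apply: contraTneq vg => ->; rewrite mul0r ltxx.
have [||e e0 cone] := @rdef_lt0_on_cone _ a b eta theta ha htheta (p 0 1) 2
  (- complex.Re (v 0 0 * gam) / normc (v 0 0)).
- exact: flat.
- by rewrite divr_gt0// oppr_gt0.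
have v1 := normc_ge0 (v 0 1).
have V0 : 0 < normc (v 0 1) ^+ 2 + 1 by rewrite ltr_wpDl// sqr_ge0.
near=> t.
have t0 : 0 < t by near: t; exact: nbhs_right_gt.
have tE (z : R[i]) : normc (t%:C * z) = t * normc z.
  by rewrite normcM normc_real gtr0_norm.
rewrite OmegaE /=; apply: cone.
all: rewrite !mxE ?p0 ?add0r ?[p 0 1 + _]addrC ?addrK !tE.
- rewrite mulr_gt0//= -ltr_pdivlMr//; near: t; apply: nbhs_right_lt.
  exact: divr_gt0.
- apply: (@le_lt_trans _ _ (t * (normc (v 0 1) + 1))).
    by rewrite ler_pM2l// lerDl.
  rewrite -ltr_pdivlMr; last by rewrite ltr_wpDl.
  by near: t; apply: nbhs_right_lt; rewrite divr_gt0// ltr_wpDl.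
- rewrite mulNr mulNr opprK [leRHS]mulrCA divfK ?gt_eqF// -mulrA.
  by case: (v 0 0 * gam) => x y /=; rewrite mul0r subr0.
- rewrite exprMn [leRHS]mulrCA [t ^+ 2]expr2 -[t * t * _]mulrA ler_pM2l//.
  apply: (@le_trans _ _ (t * (normc (v 0 1) ^+ 2 + 1))).
    by rewrite ler_pM2l// lerDl.
  rewrite -ler_pdivlMr// ltW//; near: t; apply: nbhs_right_lt.
  by apply: divr_gt0 => //; exact: mulr_gt0.
Unshelve. all: by end_near. Qed.

Lemma notin_Omega : ~ Omega p.
Proof. by rewrite OmegaE /= rp ltxx. Qed.

Lemma boundary_point : boundary Omega p.
Proof.
split; last by move=> /interior_subset; exact: notin_Omega.
move=> B nB; pose v : Cvec R 2 := - gam^* *: delta_mx 0 0.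
have vg : complex.Re (v 0 0 * gam) < 0.
  rewrite !mxE /= mulr1; have : 0 < normc gam ^+ 2 by rewrite exprn_gt0// normc_gt0.
  by rewrite sqr_normcE; case: (gam) => x y /=; nra.
have nB' := near_sector v 0 nB.
have nO := half_space_enters vg.
have [t [[t0 Ot] Bt]] : exists t : R, (0 < t /\ Omega (p + t%:C *: v)) /\
    forall s, 0 <= s <= t -> B (p + t%:C *: v + s%:C *: 0).
  apply: (@filter_ex _ (0 : R)^'+).
  by do ![apply: filterI => //]; exact: nbhs_right_gt.
exists (p + t%:C *: v); split => //.
by have := Bt 0; rewrite scaler0 addr0 lexx ltW//; exact.
Qed.

(** The normal is defined through an arbitrary local defining function, so it
    has to be read off from [Omega] alone: the half-space of entering directions
    determines the direction of the gradient, hence [N = (gam^* / |gam|, 0)]. *)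
Lemma outward_normal_on_axis (N : Cvec R 2) : outward_unit_normal Omega p N ->
  N 0 1 = 0 /\ N 0 0 * gam = (normc gam)%:C.
Proof.
move=> [rho drho ->]; have [U [[Uo Up] CU _ g0]] := drho.
have [|g1 gg] := @polar_half_space R gam (grad rho p) gam0.
  move=> v /half_space_enters nO; rewrite -(rderiv_grad _ Uo Up CU).
  exact: rderiv_le0_of_entering drho notin_Omega nO.
have g00 : grad rho p 0 0 != 0.
  apply: contra_neq g0 => g00; apply/rowP => j; rewrite [RHS]mxE.
  by case: (unliftP 0 j) => [i ->|-> //]; rewrite -g1 (ord1 i); congr (_ _ _); exact/val_inj.
have nE : enorm (grad rho p) = normc (grad rho p 0 0).
  by rewrite enorm2E g1 normc0 expr0n addr0 sqrtr_sqr ger0_norm// normc_ge0.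
rewrite nE mxE g1 mulr0 mxE; split => //.
by rewrite -mulrA gg -rmorphM mulKf// gt_eqF// normc_gt0.
Qed.

(** The points of the disc have [z1 = - (delta + w1) N1] and
    [|z2 - p2| = |w2|], where [N1 gam = |gam|].  With [|w1| <= delta / 2], the
    modulus of [z1] lies between [delta / 2] and [3 delta / 2], and [Re (z1 gam)]
    is at most [- |gam| delta / 2], that is at most [- (|gam| / 3) |z1|]; so they
    lie in the cone of opening [|gam| / 3] and order [k] once [c2^k <= e / 2]. *)
Lemma disc_property_on_axis (k : nat) (N L : Cvec R 2) : (0 < k)%N ->
  outward_unit_normal Omega p N -> unit_complex_tangent N L ->
  disc_property_along k Omega p N L.
Proof.
move=> k0 /outward_normal_on_axis[N1 Ng] NL.
have ng0 : 0 < normc gam by rewrite normc_gt0.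
have N0 : N 0 0 != 0.
  apply: contra_eq_neq Ng => ->; rewrite mul0r eq_sym.
  by apply/eqP => -[h]; move: ng0; rewrite h ltxx.
have nN : normc (N 0 0) = 1.
  apply: (mulIf (lt0r_neq0 ng0)); rewrite -normcM Ng normc_real mul1r.
  by rewrite ger0_norm// normc_ge0.
have [L0 L1] := complex_tangent_of_axis_normal N1 N0 NL.
have kap0 : 0 < normc gam / 3 by rewrite divr_gt0.
have [e e0 cone] := @rdef_lt0_on_cone _ a b eta theta ha htheta (p 0 1) k _
  (flat k) kap0.
exists (Num.min 1 (e / 2)), (1 / 2), (Num.min 1 (e / 2)).
have m0 : 0 < Num.min 1 (e / 2) by rewrite lt_min ltr01 divr_gt0.
split => //.
move=> delta d0; rewrite le_min => /andP[d1 de] Q _ [[w1 w2] [/= W1 W2] <-].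
set z := Q - _ + _.
have z0 : z 0 0 = - ((delta%:C + w1) * N 0 0).
  by rewrite /z /Q !mxE p0 L0 mulr0 addr0 sub0r -opprD mulrDl.
have z1 : z 0 1 - p 0 1 = w2 * L 0 1.
  by rewrite /z /Q !mxE N1 !mulr0 !subr0 addrC addKr.
have nz0 : normc (z 0 0) = normc (delta%:C + w1).
  by rewrite z0 normcN normcM nN mulr1.
have nz1 : normc (z 0 1 - p 0 1) = normc w2 by rewrite z1 normcM L1 mulr1.
have Rew1 := le_trans (Re_le_normc w1) W1; rewrite ler_norml in Rew1.
have hRe : complex.Re (z 0 0 * gam) = - ((delta + complex.Re w1) * normc gam).
  rewrite z0 mulNr -mulrA Ng; case: (w1) => x y /=; ring.
have lo : delta / 2 <= normc (delta%:C + w1).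
  apply: le_trans (Re_le_normc _); rewrite (le_trans _ (ler_norm _))//.
  by rewrite raddfD /=; case/andP: Rew1 => h _; lra.
have hi : normc (delta%:C + w1) <= 3 / 2 * delta.
  by apply: le_trans (le_normcD _ _) _; rewrite normc_real gtr0_norm//; lra.
set c2 := Num.min 1 (e / 2) in m0 W2.
have c2e : c2 <= e / 2 by rewrite /c2 ge_min lexx orbT.
have c21 : c2 <= 1 by rewrite /c2 ge_min lexx.
set dk := delta `^ k%:R^-1 in W2.
have dk0 : 0 <= dk by exact: powR_ge0.
have dk1 : dk <= 1.
  have := @ge0_ler_powR R k%:R^-1 _ delta 1 _ _ d1.
  by rewrite powR1 invr_ge0 ler0n !nnegrE ler01 (ltW d0); exact.
have dkk : dk ^+ k = delta.
  by rewrite -powR_mulrn// -powRrM mulVf ?powRr1 ?(ltW d0)// pnatr_eq0 -lt0n.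
rewrite OmegaE /=; apply: cone; rewrite ?nz0 ?nz1.
- apply/andP; split; first by apply: (lt_le_trans _ lo); rewrite divr_gt0.
  by apply: le_lt_trans hi _; lra.
- apply: le_lt_trans W2 _; apply: (@le_lt_trans _ _ c2); last by lra.
  by rewrite ler_piMr// ltW.
- rewrite hRe lerN2 -[leLHS]mulrA [leLHS]mulrC ler_pM2r//.
  by move: hi; case/andP: Rew1 => h _; move: (normc (_ + _)) => n hi; lra.
- apply: (@le_trans _ _ ((c2 * dk) ^+ k)).
    by rewrite lerXn2r ?nnegrE ?normc_ge0 ?mulr_ge0// ltW.
  (* [c2 <= 1] and [0 < k] give [c2 ^+ k <= c2]. *)
  rewrite exprMn dkk; apply: (@le_trans _ _ (c2 * delta)).
    by rewrite ler_pM2r// -[leRHS]expr1 ler_wiXn2l// ltW.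
  apply: (@le_trans _ _ (e / 2 * delta)); first by rewrite ler_pM2r.
  by rewrite -mulrA ler_pM2l//; move: lo; lra.
Qed.

End BoundaryPoint.

Theorem proposition4p10 (R : realType)
  (a : Cplx R -> Cplx R) (ha : csmooth a) (ha0 : a 0 != 0)
  (b : R) (hb : b != 0)
  (eta : R -> R) (heta : smooth1 eta)
  (I : set R) (hI : is_interval I)
  (hIpos : exists x y : R, [/\ I x, I y & x < y])
  (hetaI : eta @^-1` [set - b ^+ 2] = I)
  (theta : Cplx R -> R) (htheta : smooth theta)
  (Omega : set (Cvec R 2))
  (hdom : smooth_domain Omega (rdef a b eta theta)) :
  forall k : nat, (0 < k)%N ->
  forall p : Cvec R 2, Eset b eta p -> disc_property k Omega p.
Proof.
move=> k k0 p [p0 ep].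
have [dOm sr OmegaE gr] := hdom.
have Ip : I (normc (p 0 1) ^+ 2) by rewrite -hetaI.
have twist0 : twist a b theta (0, p 0 1) != 0.
  rewrite -normc_gt0 !normcM normc_conj normc_real /= cos2Dsin2 sqrtr1 mulr1.
  by rewrite mulr_gt0 ?normr_gt0 ?normc_gt0.
have rp : rdef a b eta theta p = 0.
  rewrite rdefE p0 ep normc0 expr0n /= !mul0r.
  by rewrite /= mulr0 addNr !addr0.
have flat (m : nat) :
    power_bounded (fun u => eta u + b ^+ 2) (normc (p 0 1) ^+ 2) m.
  apply: (flat_on_interval hI hIpos m _ _ Ip); first exact: smooth1_addr.
  by move=> u; rewrite -hetaI /= => ->; rewrite addNr.
split.
- split=> // q bq; exists (rdef a b eta theta), setT; split.
  + by split; [exact: openT|].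
  + exact: sr.
  + by rewrite -OmegaE.
  + exact: gr.
- exact: (boundary_point ha htheta OmegaE p0 rp flat twist0).
- move=> N L NN LL; exact: (disc_property_on_axis ha htheta OmegaE p0 rp flat twist0 k0 NN LL).
Qed.
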